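(* Consider pairs of scalar discrete-time systems $S_i:\ x_{t+1}=a_i x_t+b_i u_t$, $i\in\{1,2\}$, with $a_i,b_i\in\mathbb{R}$ and $b_i\neq 0$. Suppose that one of the following two conditions holds: (1) $|a_1|>1$, $|a_2|>1$, $|a_1-a_2|>2$, and $b_1=b_2$; or (2) $a_1=a_2=a$ for some $a>1$, and $\dfrac{b_1}{b_2}>\dfrac{a+1}{a-1}$. Then the pair $(S_1,S_2)$ is not co-stabilizable by any linear static state feedback controller, but it is co-stabilizable by some linear dynamic state feedback controller.
   Context: A system $(\mathbf{A},\mathbf{B})$ with $\mathbf{A}\in\mathbb{R}^{n\times n}$, $\mathbf{B}\in\mathbb{R}^{n\times m}$ denotes the fully observed discrete-time linear time-invariant system $\mathbf{x}_{t+1}=\mathbf{A}\mathbf{x}_t+\mathbf{B}\mathbf{u}_t$; here $n=m=1$. $\rho(\cdot)$ denotes the spectral radius of a real square matrix. Linear static state feedback: $\mathbf{u}_t=\mathbf{K}\mathbf{x}_t$ with $\mathbf{K}\in\mathbb{R}^{m\times n}$. A pair $(\mathbf{A}_1,\mathbf{B}_1),(\mathbf{A}_2,\mathbf{B}_2)$ is co-stabilizable by linear static state feedback if there is a single $\mathbf{K}\in\mathbb{R}^{m\times n}$ with $\rho(\mathbf{A}_i+\mathbf{B}_i\mathbf{K})<1$ for both $i=1,2$. Linear dynamic state feedback: $\mathbf{z}_{t+1}=\mathbf{F}\mathbf{z}_t+\mathbf{G}\mathbf{x}_t$, $\mathbf{u}_t=\mathbf{H}\mathbf{z}_t+\mathbf{K}\mathbf{x}_t$,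 where $\mathbf{z}_t\in\mathbb{R}^p$, $\mathbf{F}\in\mathbb{R}^{p\times p}$, $\mathbf{G}\in\mathbb{R}^{p\times n}$, $\mathbf{H}\in\mathbb{R}^{m\times p}$, $\mathbf{K}\in\mathbb{R}^{m\times n}$. The pair is co-stabilizable by linear dynamic state feedback if there exist an integer $p\ge 0$ and real matrices $(\mathbf{K},\mathbf{H},\mathbf{G},\mathbf{F})$ of these sizes (the same for both systems) such that $\rho\!\left(\begin{bmatrix}\mathbf{A}_i+\mathbf{B}_i\mathbf{K} & \mathbf{B}_i\mathbf{H}\\ \mathbf{G}&\mathbf{F}\end{bmatrix}\right)<1$ for both $i=1,2$. *)

(* Defs.v *)
From mathcomp Require Import all_boot all_order all_algebra.
From mathcomp Require Import classical_sets reals complex.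

Set Implicit Arguments.
Unset Strict Implicit.
Unset Printing Implicit Defensive.

Import Order.TTheory GRing.Theory Num.Theory.

Local Open Scope ring_scope.

(* Since [normc] is real valued and a matrix has finitely many eigenvalues, the
   supremum is a maximum when 0 < n; it is [sup set0 = 0] when n = 0. *)
Definition spectral_radius (R : realType) (n : nat) (A : 'M[R]_n) : R :=
  sup [set ComplexField.Normc.normc z
      | z in [set z : R[i] | eigenvalue (map_mx (real_complex R) A) z]]%classic.

Definition static_costabilizable (R : realType) (n m : nat)
    (A1 : 'M[R]_n) (B1 : 'M[R]_(n, m)) (A2 : 'M[R]_n) (B2 : 'M[R]_(n, m)) :
    Prop :=
  exists K : 'M[R]_(m, n),
    spectral_radius (A1 + B1 *m K) < 1 /\ spectral_radius (A2 + B2 *m K) < 1.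

(* The block matrices are the closed loops of x' = A_i x + B_i u with the
   controller z' = F z + G x, u = H z + K x, in the state (x, z). *)
Definition dynamic_costabilizable (R : realType) (n m : nat)
    (A1 : 'M[R]_n) (B1 : 'M[R]_(n, m)) (A2 : 'M[R]_n) (B2 : 'M[R]_(n, m)) :
    Prop :=
  exists (p : nat) (K : 'M[R]_(m, n)) (H : 'M[R]_(m, p))
         (G : 'M[R]_(p, n)) (F : 'M[R]_p),
    spectral_radius (block_mx (A1 + B1 *m K) (B1 *m H) G F) < 1 /\
    spectral_radius (block_mx (A2 + B2 *m K) (B2 *m H) G F) < 1.

(* Main.v *)
(** A controller with transfer function n / d (d monic, deg n <= deg d) gives
    the two closed loops the characteristic polynomials
    P_i = (z - a_i) d - b_i n.  Conversely, prescribed P_1 and P_2 come from a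
    proper controller under one linear condition.  For b_1 = b_2 it is
    P_2 - P_1 = (a_1 - a_2) d: the sums of the roots differ by a_1 - a_2,
    achieved by (z - r)^N and (z + r)^N with r = (a_1 - a_2) / 2N.  For
    a_1 = a_2 = a it is P_1(a) / P_2(a) = b_1 / b_2, achieved by (z + s)^N and
    (z - s)^N with ((a + s) / (a - s))^N = b_1 / b_2.  Both r and s are less
    than 1 in absolute value for N large. *)
Require Import Defs.
From mathcomp Require Import all_boot all_order all_algebra.
From mathcomp Require Import classical_sets reals complex.
From mathcomp Require Import ring lra.

Import Order.TTheory GRing.Theory Num.Theory.

Local Open Scope ring_scope.

Import ComplexField.Normc.

(** * Spectral radii and static feedback for scalar systems *)

Lemma normc_real (R : rcfType) (c : R) : normc c%:C%C = `|c|.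
Proof. by rewrite /= expr0n /= addr0 sqrtr_sqr. Qed.

Lemma spectral_radius_lt1 (R : realType) (n : nat) (A : 'M[R]_n) (r : R) :
  `|r| < 1 ->
  (forall z : R[i], eigenvalue (map_mx (real_complex R) A) z -> z = r%:C%C) ->
  spectral_radius A < 1.
Proof.
move=> r1 Ar; rewrite /spectral_radius; set S := (X in sup X).
(* Without eigenvalues (as for [n = 0]) [sup] takes the value 0; otherwise [|r|] bounds a nonempty
   set of moduli. *)
have [->|S0] := eqVneq S set0; first by rewrite sup0 ltr01.
apply: le_lt_trans r1; apply: ge_sup; first exact/set0P.
by move=> _ [z /Ar -> <-]; rewrite normc_real.
Qed.

Lemma normr_le_spectral_radius_scalar (R : realType) (c : R) :
  `|c| <= spectral_radius (c%:M : 'M[R]_1).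
Proof.
have eig z : eigenvalue (map_mx (real_complex R) (c%:M : 'M[R]_1)) z =
             (z == c%:C%C).
  rewrite map_scalar_mx; apply/eigenvalueP/eqP => [[v]|->].
    rewrite mul_mx_scalar => /eqP; rewrite -subr_eq0 -scalerBl scaler_eq0.
    by rewrite subr_eq0 => /orP[/eqP-> //|->].
  by exists 1%:M; rewrite ?mul_mx_scalar // oner_neq0.
rewrite -normc_real; apply: ub_le_sup; last by exists c%:C%C; rewrite //= eig.
by exists `|c| => _ [z + <-]; rewrite /= eig => /eqP ->; rewrite normc_real.
Qed.

Lemma static_costabilizable_scalar (R : realType) (a1 a2 b1 b2 : R) :
  static_costabilizable (a1%:M : 'M[R]_1) (b1%:M : 'M[R]_(1, 1))
                        (a2%:M : 'M[R]_1) (b2%:M : 'M[R]_(1, 1)) ->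
  exists k : R, `|a1 + b1 * k| < 1 /\ `|a2 + b2 * k| < 1.
Proof.
case=> K; rewrite (mx11_scalar K) -!scalar_mxM -!raddfD /= => -[h1 h2].
exists (K 0 0); split.
  exact: le_lt_trans (normr_le_spectral_radius_scalar _ _) h1.
exact: le_lt_trans (normr_le_spectral_radius_scalar _ _) h2.
Qed.

(** * Realization of a controller and its closed loop *)

(** Observable canonical form: for [d] monic of degree p + 1 and [h] of smaller degree, [ctrlF],
    [ctrlG] and [ctrlH] together realize the transfer function h / d. *)
Definition ctrlF (R : nzRingType) (p : nat) (d : {poly R}) : 'M[R]_p.+1 :=
  \matrix_(i, j) if j == ord_max then - d`_i else (i == j.+1 :> nat)%:R.
Definition ctrlG (R : nzRingType) (p : nat) (h : {poly R}) : 'M[R]_(p.+1, 1) :=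
  \col_i h`_i.
Definition ctrlH (R : nzRingType) (p : nat) : 'M[R]_(1, p.+1) :=
  \row_j (j == ord_max)%:R.

(* A row eigenvector (x, w) of the closed loop of the companion realization
   satisfies w_j = z^j w_0, then d(z) w_0 = b x and (z - a - b k) x = h(z) w_0;
   so w_0 != 0 and z is a root of the closed-loop characteristic polynomial,
   without any determinant computation. *)
Lemma closed_loop_eigenvalue (R : realType) (p : nat) (d h : {poly R})
    (k a b : R) (z : R[i]) :
  (size d <= p.+2)%N -> d`_p.+1 = 1 -> (size h <= p.+1)%N -> b != 0 ->
  eigenvalue (map_mx (real_complex R)
    (block_mx (a%:M + b%:M *m k%:M) (b%:M *m ctrlH R p)
              (ctrlG R p h) (ctrlF R p d))) z ->
  root (map_poly (real_complex R) (('X - a%:P) * d - b *: (k *: d + h))) z.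
Proof.
move=> sd d1 sh b0 /eigenvalueP[v]; rewrite -(hsubmxK v).
move: (lsubmx v) (rsubmx v) => x w.
rewrite map_block_mx mul_row_block scale_row_mx => /eq_row_mx[ex ew] v0.
pose f : {rmorphism R -> R[i]} := real_complex R.
rewrite -[real_complex R]/(f : R -> R[i]).
have {ex}ex : x 0 0 * f (a + b * k) + \sum_i w 0 i * f h`_i = z * x 0 0.
  move/matrixP/(_ 0 0): ex; rewrite !mxE big_ord1 => <-; congr (_ + _).
    by rewrite !mxE big_ord1 !mxE /= !mulr1n.
  by apply: eq_bigr => i _; rewrite !mxE.
have {}ew j : x 0 0 * f (b * (j == ord_max)%:R) +
    \sum_i w 0 i * f (ctrlF R p d i j) = z * w 0 j.
  move/matrixP/(_ 0 j): ew; rewrite !mxE big_ord1 => <-; congr (_ + _).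
    by rewrite !mxE big_ord1 !mxE /= !mulr1n.
  by apply: eq_bigr => i _; rewrite !mxE.
clearbody f.
have wS (j : nat) : (j <= p)%N -> w 0 (inord j) = z ^+ j * w 0 0.
  elim: j => [|j IH] jp.
    by rewrite expr0 mul1r; congr (w 0 _); apply: val_inj; rewrite /= inordK.
  have := ew (inord j); rewrite IH ?(ltnW jp) // mulrA -exprS => <-.
  have jE : (inord j == ord_max :> 'I_p.+1) = false.
    by apply/eqP => /(congr1 val); rewrite /= inordK ?leqW // => jE;
      rewrite jE ltnn in jp.
  rewrite jE mulr0 rmorph0 mulr0 add0r (bigD1 (inord j.+1)) // big1.
    by rewrite mxE jE !inordK ?(leqW jp) // eqxx rmorph1 mulr1 /= addr0.
  move=> i ij; rewrite mxE jE inordK ?(leqW jp) //.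
  case: eqP => [ie|]; last by rewrite rmorph0 mulr0.
  by case/eqP: ij; apply: val_inj; rewrite /= inordK.
have wE (i : 'I_p.+1) : w 0 i = z ^+ i * w 0 0.
  by rewrite -wS -1?ltnS // inord_val.
have w00 : w 0 0 != 0.
  apply: contraNneq v0 => w0.
  have {}w0 i : w 0 i = 0 by rewrite wE w0 mulr0.
  have w0' : w = 0 by apply/matrixP => i j; rewrite ord1 w0 mxE.
  (* With w = 0 the last column reduces to b x = 0, so the whole eigenvector would vanish. *)
  have := ew ord_max; rewrite eqxx mulr1 w0 mulr0 big1 => [|i _].
    rewrite addr0 => /eqP; rewrite mulf_eq0 fmorph_eq0 (negPf b0) orbF.
    move=> /eqP x0.
    by rewrite w0' (mx11_scalar x) x0 raddf0 row_mx0.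
  by rewrite w0 mul0r.
have horner_sum (q : {poly R}) n : (size q <= n)%N ->
    (map_poly f q).[z] * w 0 0 = \sum_(i < n) z ^+ i * w 0 0 * f q`_i.
  move=> sq; rewrite (@horner_coef_wide _ n) ?size_map_poly // mulr_suml.
  by apply: eq_bigr => i _; rewrite coef_map -mulrA mulrC.
have dE : (map_poly f d).[z] * w 0 0 = f b * x 0 0.
  rewrite (horner_sum _ p.+2) // big_ord_recr /= d1 rmorph1 mulr1 exprS.
  have := ew ord_max; rewrite eqxx mulr1 [w 0 ord_max]wE /= mulrA => <-.
  rewrite addrCA -big_split /= big1 ?addr0 1?mulrC // => i _.
  by rewrite [w 0 i]wE mxE eqxx rmorphN mulrN /= subrr.
have hE : (map_poly f h).[z] * w 0 0 = (z - f (a + b * k)) * x 0 0.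
  rewrite (horner_sum _ p.+1) // mulrBl -ex [f _ * _]mulrC addrC addKr.
  by apply: eq_bigr => i _; rewrite -wE.
rewrite /root -(mulIr_eq0 _ (mulIf w00)).
rewrite rmorphB rmorphM rmorphB /= map_polyX map_polyC /=.
rewrite !(map_polyZ, rmorphD) /=.
rewrite !map_polyZ /= !hornerE /=; apply/eqP.
transitivity ((z - f a - f b * f k) * ((map_poly f d).[z] * w 0 0)
   - f b * ((map_poly f h).[z] * w 0 0)); first by ring.
by rewrite dE hE rmorphD rmorphM; ring.
Qed.

Lemma dynamic_costabilizable_scalar (R : realType) (a1 a2 b1 b2 r1 r2 : R)
    (p : nat) (d n : {poly R}) :
  b1 != 0 -> b2 != 0 -> `|r1| < 1 -> `|r2| < 1 ->
  (size d <= p.+2)%N -> d`_p.+1 = 1 -> (size n <= p.+2)%N ->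
  ('X - a1%:P) * d - b1 *: n = ('X - r1%:P) ^+ p.+2 ->
  ('X - a2%:P) * d - b2 *: n = ('X - r2%:P) ^+ p.+2 ->
  dynamic_costabilizable (a1%:M : 'M[R]_1) (b1%:M : 'M[R]_(1, 1))
                         (a2%:M : 'M[R]_1) (b2%:M : 'M[R]_(1, 1)).
Proof.
move=> b10 b20 r1lt r2lt sd d1 sn e1 e2.
(* Division of n by d: n / d = k + h / d, a direct gain plus a strictly proper part. *)
pose k := n`_p.+1; pose h := n - k *: d.
have sh : (size h <= p.+1)%N.
  apply/leq_sizeP => j; rewrite leq_eqVlt => /orP[/eqP<-|pj].
    by rewrite coefB coefZ d1 mulr1 subrr.
  by rewrite coefB coefZ !nth_default ?mulr0 ?subr0 // (leq_trans _ pj).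
have nE : n = k *: d + h by rewrite addrC subrK.
have stab (a b r : R) : b != 0 -> `|r| < 1 ->
    ('X - a%:P) * d - b *: n = ('X - r%:P) ^+ p.+2 ->
    spectral_radius (block_mx (a%:M + b%:M *m k%:M) (b%:M *m ctrlH R p)
                              (ctrlG R p h) (ctrlF R p d)) < 1.
  move=> b0 rlt e; apply: (@spectral_radius_lt1 _ _ _ r) => // z.
  move=> /(closed_loop_eigenvalue _ _ _ _ _ _ _ _ sd d1 sh b0).
  rewrite -nE e rmorphXn rmorphB /= map_polyX map_polyC /=.
  by rewrite /root horner_exp expf_eq0 /= hornerXsubC subr_eq0 => /eqP.
exists p.+1, k%:M, (ctrlH R p), (ctrlG R p h), (ctrlF R p d).
by split; [apply: stab e1|apply: stab e2].
Qed.

Lemma size_subr_leq (R : nzRingType) (m : nat) (p q : {poly R}) :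
  (size p <= m.+1)%N -> (size q <= m.+1)%N -> p`_m = q`_m ->
  (size (p - q)%R <= m)%N.
Proof.
move=> sp sq pq; apply/leq_sizeP => j; rewrite leq_eqVlt => /orP[/eqP<-|mj].
  by rewrite coefB pq subrr.
by rewrite coefB !nth_default ?subrr // (leq_trans _ mj).
Qed.

Lemma coef_exp_XsubC_lead (R : nzRingType) (r : R) (m : nat) :
  (('X - r%:P) ^+ m)`_m = 1.
Proof.
have /monicP <- : ('X - r%:P) ^+ m \is monic by rewrite monic_exp ?monicXsubC.
by rewrite lead_coefE size_exp_XsubC.
Qed.

(** This is minus the sum of the roots; it provides the leading coefficient of [d] when the gains
    are equal. *)
Lemma coef_exp_XsubC_sublead (R : nzRingType) (r : R) (m : nat) :
  (('X - r%:P) ^+ m.+1)`_m = - (r *+ m.+1).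
Proof.
elim: m => [|m IH]; first by rewrite expr1 coefB coefX coefC sub0r.
rewrite exprS mulrBl coefB coefXM coefCM IH coef_exp_XsubC_lead mulr1.
by rewrite [r *+ m.+2]mulrSr opprD.
Qed.

(** * Equal gains *)

Lemma dynamic_costabilizable_eq_gain (R : realType) (a1 a2 b : R) :
  b != 0 -> a1 != a2 ->
  dynamic_costabilizable (a1%:M : 'M[R]_1) (b%:M : 'M[R]_(1, 1))
                         (a2%:M : 'M[R]_1) (b%:M : 'M[R]_(1, 1)).
Proof.
move=> b0 a12; pose D := a1 - a2; pose p := Num.bound `|D|.
have D0 : D != 0 by rewrite subr_eq0.
have pD : `|D| < p.+2%:R.
  by apply: (lt_trans (archi_boundP (normr_ge0 D))); rewrite ltr_nat ltnW.
have N0 : p.+2%:R != 0 :> R by rewrite pnatr_eq0.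
pose r := D / (2 * p.+2%:R).
have rN : r *+ p.+2 + r *+ p.+2 = D.
  by rewrite -mulrnDl -mulr_natr /r; move: N0; move: p.+2%:R => c c0; field.
have r1 : `|r| < 1.
  rewrite normrM normfV ltr_pdivrMr ?normr_gt0 ?mulf_neq0 ?pnatr_eq0 // mul1r.
  by rewrite normrM !normr_nat; have := ler0n R p.+2; lra.
pose P (s : R) := ('X - s%:P) ^+ p.+2.
have sP s : size (P s) = p.+3 by rewrite size_exp_XsubC.
(* Subtracting the two closed-loop identities forces this [d]; [rN] makes it monic of degree p +
   1. *)
pose d := D^-1 *: (P (- r) - P r).
have sd : (size d <= p.+2)%N.
  rewrite (leq_trans (size_scale_leq _ _)) // size_subr_leq ?sP //.
  by rewrite !coef_exp_XsubC_lead.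
have d1 : d`_p.+1 = 1.
  rewrite coefZ coefB !coef_exp_XsubC_sublead mulNrn opprK rN.
  exact: mulVf.
(* Solves the first identity for [n]; the coefficients of degree p + 2 cancel, so n / d is
   proper. *)
pose n := b^-1 *: (('X - a1%:P) * d - P r).
have sn : (size n <= p.+2)%N.
  rewrite (leq_trans (size_scale_leq _ _)) // size_subr_leq ?sP //.
    by rewrite (leq_trans (size_polyMleq _ _)) // size_XsubC.
  rewrite coef_exp_XsubC_lead mulrBl coefB coefXM coefCM d1.
  by rewrite [d`_p.+2]nth_default // mulr0 subr0.
have bn : b *: n = ('X - a1%:P) * d - P r by rewrite scalerA divff // scale1r.
apply: (@dynamic_costabilizable_scalar R a1 a2 b b r (- r) p d n) => //.
- by rewrite normrN.
- by rewrite bn subKr.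
have Dd : D%:P * d = P (- r) - P r.
  by rewrite mul_polyC scalerA divff // scale1r.
rewrite bn; transitivity (D%:P * d + P r); first by rewrite polyCB; ring.
by rewrite Dd subrK.
Qed.

(** * Equal poles *)

Lemma bernoulli_ineq (R : realDomainType) (x : R) (m : nat) :
  0 <= x -> 1 + x *+ m <= (1 + x) ^+ m.
Proof.
move=> x0; elim: m => [|m IH]; first by rewrite mulr0n addr0 expr0.
have xm : 0 <= x *+ m by rewrite mulrn_wge0.
rewrite exprS mulrS; apply: (@le_trans _ _ ((1 + x) * (1 + x *+ m))).
  by nra.
by rewrite ler_wpM2l // addr_ge0.
Qed.

Lemma dynamic_costabilizable_eq_pole (R : realType) (a b1 b2 : R) :
  b1 != 0 -> b2 != 0 -> 1 < a -> 1 < b1 / b2 ->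
  dynamic_costabilizable (a%:M : 'M[R]_1) (b1%:M : 'M[R]_(1, 1))
                         (a%:M : 'M[R]_1) (b2%:M : 'M[R]_(1, 1)).
Proof.
move=> b10 b20 a1; set t := b1 / b2 => t1.
have b1E : b1 = t * b2 by rewrite divfK.
have D0 : b2 - b1 != 0.
  by rewrite b1E -{1}[b2]mul1r -mulrBl mulf_neq0 // subr_eq0 lt_eqF.
(* [q0] is (a + 1) / (a - 1), the value of (a + s) / (a - s) at s = 1; thus q < q0 will mean s <
   1. *)
pose e := 2 / (a - 1); have e0 : 0 < e by rewrite divr_gt0 ?subr_gt0.
pose q0 := 1 + e.
have [p tp] : exists p : nat, t < p%:R * e.
  exists (Num.bound (t / e)); rewrite -ltr_pdivrMr //; apply: archi_boundP.
  by rewrite divr_ge0 ?ltW // (lt_trans ltr01).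
have tq0 : t < q0 ^+ p.+2.
  apply: lt_le_trans (bernoulli_ineq _ _ _ (ltW e0)).
  by rewrite !mulrS -mulr_natl; lra.
(* The root of order p + 2 of [t], by the intermediate value theorem on [1, q0]. *)
have [q /andP[q1 qq0] /rootP] :
    exists2 q, 1 <= q <= q0 & root ('X^(p.+2) - t%:P) q.
  apply: poly_ivt; first by rewrite lerDl ltW.
  by rewrite !hornerE /= expr1n subr_le0 subr_ge0 !ltW.
rewrite !hornerE /= => /eqP; rewrite subr_eq0 => /eqP qt.
have {}qq0 : q < q0.
  by rewrite lt_neqAle qq0 andbT; apply: contraTneq tq0 => <-; rewrite qt ltxx.
(* The solution of (a + s) / (a - s) = q. *)
pose s := a * (q - 1) / (q + 1).
have q10 : q + 1 != 0 by apply: lt0r_neq0; lra.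
have s0 : 0 <= s by apply: divr_ge0; nra.
have s1 : s < 1.
  rewrite ltr_pdivrMr; last by lra.
  have : (q - 1) * (a - 1) < 2 by rewrite -ltr_pdivlMr ?subr_gt0 // ltrBlDl.
  by nra.
have qs : a + s = q * (a - s) by rewrite /s; field.
pose P (s : R) := ('X - s%:P) ^+ p.+2.
have sP u : size (P u) = p.+3 by rewrite size_exp_XsubC.
(* Eliminating n from the two identities gives (X - a) d = Q, solvable because b2 (a + s)^(p+2) = b1
   (a - s)^(p+2). *)
pose Q := (b2 - b1)^-1 *: (b2 *: P (- s) - b1 *: P s).
have : root Q a.
  rewrite /root /Q /P !(hornerZ, hornerD, hornerN, horner_exp, hornerX, hornerC).
  rewrite opprK qs.
  by rewrite exprMn qt mulrA [b2 * t]mulrC -b1E subrr mulr0.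
case/factor_theorem => d dE.
have sQ : (size Q <= p.+3)%N.
  rewrite (leq_trans (size_scale_leq _ _)) // (leq_trans (size_polyD _ _)) //.
  by rewrite size_polyN geq_max !(leq_trans (size_scale_leq _ _)) ?sP.
have Q1 : Q`_p.+2 = 1.
  by rewrite coefZ coefB !coefZ !coef_exp_XsubC_lead !mulr1 mulVf.
have Q0 : Q != 0.
  by apply: contra_eq_neq Q1 => ->; rewrite coef0 eq_sym oner_neq0.
have d0 : d != 0 by apply: contraNneq Q0 => d0; rewrite dE d0 mul0r.
have sd : (size d <= p.+2)%N.
  by move: sQ; rewrite dE size_Mmonic ?monicXsubC // size_XsubC addn2.
have d1 : d`_p.+1 = 1.
  move: Q1; rewrite dE mulrBr coefB coefMX coefMC /=.
  by rewrite [d`_p.+2]nth_default // mul0r subr0.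
(* The difference of the two identities, in which (X - a) d cancels. *)
pose n := (b2 - b1)^-1 *: (P (- s) - P s).
have sn : (size n <= p.+2)%N.
  rewrite (leq_trans (size_scale_leq _ _)) // size_subr_leq ?sP //.
  by rewrite !coef_exp_XsubC_lead.
have sabs : `|s| < 1 by rewrite ger0_norm.
apply: (@dynamic_costabilizable_scalar R a a b1 b2 (- s) s p d n) => //.
- by rewrite normrN.
- rewrite mulrC -dE /Q /n -/(P _) -!mul_polyC.
  transitivity (((b2 - b1)^-1 * (b2 - b1))%:P * P (- s)).
    by rewrite polyCM polyCB; ring.
  by rewrite mulVf // mul1r.
rewrite mulrC -dE /Q /n -/(P _) -!mul_polyC.
transitivity (((b2 - b1)^-1 * (b2 - b1))%:P * P s).
  by rewrite polyCM polyCB; ring.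
by rewrite mulVf // mul1r.
Qed.

(** * Obstructions to static feedback, and conclusion *)

Theorem theorem1 (R : realType) (a1 a2 b1 b2 : R) :
  b1 != 0 -> b2 != 0 ->
  [/\ 1 < `|a1|, 1 < `|a2|, 2 < `|a1 - a2| & b1 = b2] \/
  (exists a : R, [/\ a1 = a, a2 = a, 1 < a & (a + 1) / (a - 1) < b1 / b2]) ->
  ~ static_costabilizable (a1%:M : 'M[R]_1) (b1%:M : 'M[R]_(1, 1))
                          (a2%:M : 'M[R]_1) (b2%:M : 'M[R]_(1, 1)) /\
  dynamic_costabilizable (a1%:M : 'M[R]_1) (b1%:M : 'M[R]_(1, 1))
                         (a2%:M : 'M[R]_1) (b2%:M : 'M[R]_(1, 1)).
Proof.
move=> b10 b20 [[_ _ a12 <-]|[a [-> -> agt1 ab]]]; split.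
- case/static_costabilizable_scalar => k [k1 k2].
  (* The common feedback term cancels, so two stable closed loops would give |a1 - a2| < 2. *)
  have := ler_normB (a1 + b1 * k) (a2 + b1 * k).
  by rewrite opprD addrACA subrr addr0; lra.
- apply: dynamic_costabilizable_eq_gain => //.
  by rewrite -subr_eq0 -normr_gt0 (lt_trans _ a12).
- case/static_costabilizable_scalar => k [].
  (* With t = b1 / b2 and y = b2 k, stability gives -1 < a + t y and y < 1 - a, hence t (a - 1) < a
     + 1, against the hypothesis. *)
  rewrite -[b1](divfK b20); move: (b1 / b2) ab => t ab.
  rewrite -mulrA !ltr_norml; move: (b2 * k) => y /andP[y1 _] /andP[_ y2].
  move: ab; rewrite ltr_pdivrMr ?subr_gt0 // => ab.
  have t0 : 0 < t by nra.
  have : t * y < t * (1 - a) by rewrite ltr_pM2l //; lra.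
  by lra.
- apply: dynamic_costabilizable_eq_pole => //; apply: lt_trans ab.
  by rewrite ltr_pdivlMr ?subr_gt0 // mul1r; lra.
Qed.
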